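(* Let $n = p_1p_2\cdots p_m q_1^{k_1}q_2^{k_2}\cdots q_r^{k_r}$, where $m\geq 1$, $r\geq 0$, $k_i\geq 2$ for all $i$, and $p_1,\ldots,p_m,q_1,\ldots,q_r$ are distinct primes, and suppose that $n$ is not prime. Let $D$ be the set of all proper divisors of $n$ (so $|D|=\tau(n)-2$, where $\tau(n)$ is the number of divisors of $n$), and let $V$ be the vertex set of the weakly zero-divisor graph $W\Gamma(\mathbb{Z}_n)$. Then the Laplacian spectrum of $W\Gamma(\mathbb{Z}_n)$ is $$\begin{pmatrix} 0 & |V| & |V|-\phi\left(\frac{n}{p_1}\right) & |V|-\phi\left(\frac{n}{p_2}\right) & \cdots & |V|-\phi\left(\frac{n}{p_m}\right)\\ 1 & \left(\sum\limits_{d\in D\setminus\{p_1,\ldots,p_m\}}\phi\left(\frac{n}{d}\right)\right)+m-1 & \phi\left(\frac{n}{p_1}\right)-1 & \phi\left(\frac{n}{p_2}\right)-1 & \cdots & \phi\left(\frac{n}{p_m}\right)-1 \end{pmatrix}.$$ In particular, $W\Gamma(\mathbb{Z}_n)$ is Laplacian integral.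
   Context: For a commutative ring $R$ with unity, the weakly zero-divisor graph $W\Gamma(R)$ is the simple undirected graph whose vertices are the nonzero zero-divisors of $R$, with two distinct vertices $x,y$ adjacent if and only if there exist nonzero $r\in\mathrm{ann}(x)$ and nonzero $s\in\mathrm{ann}(y)$ such that $rs=0$, where $\mathrm{ann}(x)=\{t\in R: tx=0\}$. $\mathbb{Z}_n$ is the ring of integers modulo $n$ and $\phi$ is Euler's totient function. A proper divisor of $n$ is an integer $d$ with $1<d<n$ and $d\mid n$. The Laplacian matrix of a finite simple graph is $D-A$, where $D$ here denotes the diagonal matrix of vertex degrees and $A$ the adjacency matrix. The Laplacian spectrum is the multiset of its eigenvalues, written as a two-row array with eigenvalues in the top row and their multiplicities in the bottom row (an entry of multiplicity $0$ means that the column contributes nothing; if a value appears in several columns its multiplicities are added). A graph is Laplacian integral if all eigenvalues of its Laplacian matrix are integers. *)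

(* Defs.v *)
From HB Require Import structures.
From mathcomp Require Import all_boot all_order all_algebra.
Set Implicit Arguments. Unset Strict Implicit. Unset Printing Implicit Defensive.
Import GRing.Theory.
Local Open Scope ring_scope.

Record sgraph := SGraph {
  vertex :> finType;
  adj : rel vertex;
  adj_sym : symmetric adj;
  adj_irrefl : irreflexive adj }.

Section Laplacian.
Variables (F : pzRingType) (G : sgraph).

Definition degree (x : G) : nat := #|[set y | adj x y]|.

(* Rows and columns are indexed by the vertices in the order of enum G. *)
Definition degree_mx : 'M[F]_#|G| :=
  diag_mx (\row_(i < #|G|) (degree (enum_val i))%:R).

Definition adjacency_mx : 'M[F]_#|G| :=
  \matrix_(i, j) (adj (enum_val i) (enum_val j))%:R.

Definition laplacian : 'M[F]_#|G| := degree_mx - adjacency_mx.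

End Laplacian.

Definition laplacian_integral (C : fieldType) (G : sgraph) : Prop :=
  forall a : C, eigenvalue (laplacian C G) a -> exists z : int, a = z%:~R.

(* The eigenvalues listed with algebraic multiplicity; the list is determined
   only up to order, so it is to be compared with perm_eq. *)
Definition spectrum (C : closedFieldType) (n : nat) (A : 'M[C]_n) : seq C :=
  sval (closed_field_poly_normal (char_poly A)).

Lemma spectrumP (C : closedFieldType) (n : nat) (A : 'M[C]_n) :
  char_poly A = \prod_(z <- spectrum A) ('X - z%:P).
Proof.
rewrite /spectrum; case: closed_field_poly_normal => s /= {1}->.
by rewrite (monicP (char_poly_monic A)) scale1r.
Qed.

Lemma mem_spectrum (C : closedFieldType) (n : nat) (A : 'M[C]_n) (a : C) :
  (a \in spectrum A) = eigenvalue A a.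
Proof. by rewrite eigenvalue_root_char spectrumP root_prod_XsubC. Qed.

Section WeaklyZeroDivisorGraph.
Variable R : finComNzRingType.

Definition ann (x : R) : {set R} := [set t | t * x == 0].

Definition zero_divisor (x : R) : bool := [exists y, (y != 0) && (x * y == 0)].

Definition wzd_vertex : finType := {x : R | (x != 0) && zero_divisor x}.

Definition wzd_adj (x y : wzd_vertex) : bool :=
  (x != y) &&
  [exists r in ann (val x), exists s in ann (val y),
     [&& r != 0, s != 0 & r * s == 0]].

Lemma wzd_adj_sym : symmetric wzd_adj.
Proof.
move=> x y; rewrite /wzd_adj eq_sym; congr (_ && _).
by apply/exists_inP/exists_inP => -[r rx /exists_inP[s sy /and3P[r0 s0 rs]]];
  exists s => //; apply/exists_inP; exists r => //; rewrite s0 r0 mulrC.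
Qed.

Lemma wzd_adj_irrefl : irreflexive wzd_adj.
Proof. by move=> x; rewrite /wzd_adj eqxx. Qed.

Definition wzd_graph : sgraph := SGraph wzd_adj_sym wzd_adj_irrefl.

End WeaklyZeroDivisorGraph.

Definition proper_divisors (n : nat) : seq nat :=
  [seq d <- divisors n | (1 < d < n)%N].

Lemma mem_proper_divisors (n d : nat) :
  (0 < n)%N -> (d \in proper_divisors n) = [&& (1 < d)%N, (d < n)%N & (d %| n)%N].
Proof. by move=> n0; rewrite mem_filter -dvdn_divisors // andbA. Qed.

Lemma proper_divisors_uniq (n : nat) : uniq (proper_divisors n).
Proof. exact/filter_uniq/divisors_uniq. Qed.

Lemma size_proper_divisors (n : nat) :
  (1 < n)%N -> size (proper_divisors n) = (size (divisors n) - 2)%N.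
Proof.
move=> n1; have n0 : (0 < n)%N by exact: ltnW.
suff /perm_size -> : perm_eq (divisors n) (1%N :: n :: proper_divisors n).
  by rewrite /= subn2.
apply: uniq_perm; first exact: divisors_uniq.
  rewrite /= proper_divisors_uniq inE !mem_proper_divisors // !ltnn /=.
  by rewrite n1 orbF neq_ltn n1.
move=> d; rewrite !inE mem_proper_divisors // -dvdn_divisors //.
case: (eqVneq d 1%N) => [->|d1]; first by rewrite dvd1n.
case: (eqVneq d n) => [->|dn] /=; first by rewrite dvdnn.
apply/idP/idP => [dvd|/and3P[] //].
by rewrite dvd ltn_neqAle eq_sym d1 (dvdn_gt0 n0 dvd) ltn_neqAle dn dvdn_leq.
Qed.

(* Main.v *)
Require Import Defs.
From mathcomp Require Import all_boot all_order all_algebra.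
Set Implicit Arguments. Unset Strict Implicit. Unset Printing Implicit Defensive.
Import GRing.Theory.

(** Write g(x) for gcd(x, n).  A nonzero r kills x in Z_n exactly when r is
a multiple of n / g(x), and passing from a nonzero r to n / gcd(r, n) turns
annihilators into divisors: x and y have nonzero annihilators r, s with r s = 0
iff there are l, l' > 1 with l | g(x), l' | g(y) and l l' | n
([annihilating_pairP]).  Such a pair exists unless g(x) = g(y) is a prime that
divides n only once ([complementary_divisorsP]): two distinct primes dividing n
have their product dividing n, and if only one prime l is available, it can be
used twice as soon as l^2 divides n.  So two distinct vertices are non-adjacent
iff g(x) = g(y) = p_i for some i.

Hence the graph is complete multipartite: its parts are the m classes
g(x) = p_i, of size phi(n / p_i), and singletons for all other vertices, of
which there are as many as the sum of phi(n / d) over the remaining proper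
divisors d.

The Laplacian of a complete multipartite graph on N vertices with k parts
of sizes c_t is computed in [char_poly_complete_multipartite].  Let P be the
vertex-part incidence matrix.  Then 'X - L is A - P B, where A is diagonal and
constant on the parts, so that A P = P A' for a diagonal k x k matrix A'.  The
Sylvester-type identity [det_intertwined] replaces the determinant of A - P B by
that of the k x k matrix A' - B P, which is a scalar matrix plus a matrix of
rank one.  The result is
'X ('X - N)^(k - 1) times the product of the ('X - (N - c_t))^(c_t - 1),
to which singletons contribute only through k. *)

(** * Nonzero elements with zero product in Z_n *)

Lemma Zp_mul_eq0 (n : nat) (x y : 'Z_n) :
  (1 < n)%N -> (x * y == 0)%R = (n %| x * y)%N.
Proof.
move=> n1; rewrite -val_eqE /= /dvdn; congr (_ %% _ == _)%N; exact: Zp_cast.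
Qed.

Lemma Zp_neq0 (n : nat) (x : 'Z_n) : (1 < n)%N -> (x != 0)%R = ~~ (n %| x)%N.
Proof.
move=> n1; rewrite -val_eqE /= /dvdn modn_small //.
by rewrite -[X in (_ < X)%N](Zp_cast n1) ltn_ord.
Qed.

Lemma ltn_Zp (n : nat) (x : 'Z_n) : (1 < n)%N -> (x < n)%N.
Proof. by move=> n1; rewrite -[X in (_ < X)%N](Zp_cast n1) ltn_ord. Qed.

(** Residues of the form n / d witness both zero divisors and adjacency. *)
Lemma Zp_codivisor (n d : nat) : (1 < n)%N -> (1 < d)%N -> (d %| n)%N ->
  exists2 r : 'Z_n, r != 0%R & r = (n %/ d)%N :> nat.
Proof.
move=> n1 d1 dn; have n0 := ltnW n1.
have lt_n : (n %/ d < n)%N by rewrite ltn_Pdiv.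
exists (inZp (n %/ d)); last by rewrite /= Zp_cast // modn_small.
rewrite Zp_neq0 //= Zp_cast // modn_small // gtnNdvd //.
by rewrite divn_gt0 ?(ltnW d1) // dvdn_leq.
Qed.

(** The correspondence is r |-> l = n / gcd(r, n), with right inverse l |-> n / l:
it sends nonzero residues to divisors l > 1, and r s = 0 becomes l l' | n because
n | gcd(r, n) gcd(s, n) and the four factors multiply to n^2. *)
Lemma annihilating_pairP (n a b : nat) : (1 < n)%N ->
  (exists r s : 'Z_n, [/\ (r != 0)%R, (s != 0)%R, (n %| r * a)%N,
              (n %| s * b)%N & (r * s == 0)%R]) <->
  (exists l l', [/\ 1 < l, 1 < l', l %| a, l' %| b & l * l' %| n])%N.
Proof.
move=> n1; have n0 := ltnW n1.
split=> [[r [s [r0 s0 ra sb rs]]] | [l [l' [l1 l'1 la l'b ll'n]]]].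
  move: r0 s0 rs; rewrite !Zp_neq0 // Zp_mul_eq0 //.
  move: (nat_of_ord r) (nat_of_ord s) ra sb => {}r {}s ra sb r0 s0 rs.
  have codiv z c : (~~ (n %| z) -> n %| z * c ->
      (1 < n %/ gcdn z n) && (n %/ gcdn z n %| c))%N.
    move=> z0 zc; have g0 : (0 < gcdn z n)%N by rewrite gcdn_gt0 n0 orbT.
    rewrite -(@dvdn_pmul2r (gcdn z n)) // divnK ?dvdn_gcdr // muln_gcdr mulnC.
    rewrite dvdn_gcd zc dvdn_mull // !andbT ltn_divRL ?dvdn_gcdr // mul1n.
    rewrite ltn_neqAle dvdn_leq ?dvdn_gcdr // andbT.
    by apply: contra z0 => /eqP <-; rewrite dvdn_gcdl.
  have /andP[l1 la] := codiv _ _ r0 ra; have /andP[l'1 l'b] := codiv _ _ s0 sb.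
  exists (n %/ gcdn r n)%N, (n %/ gcdn s n)%N; split=> //.
  have g0 : (0 < gcdn r n * gcdn s n)%N by rewrite muln_gt0 !gcdn_gt0 n0 !orbT.
  rewrite -(dvdn_pmul2r g0) mulnACA !divnK ?dvdn_gcdr // dvdn_pmul2l //.
  by rewrite muln_gcdr !muln_gcdl !dvdn_gcd rs (dvdn_mulr s) //
             dvdn_mull // dvdn_mulr.
have lln : (l %| n)%N by apply: dvdn_trans ll'n; apply: dvdn_mulr.
have l'n : (l' %| n)%N by apply: dvdn_trans ll'n; apply: dvdn_mull.
have [r r0 rE] := Zp_codivisor n1 l1 lln.
have [s s0 sE] := Zp_codivisor n1 l'1 l'n.
exists r, s; rewrite r0 s0 Zp_mul_eq0 // rE sE; split=> //.
- by rewrite -{1}(divnK lln) dvdn_mul.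
- by rewrite -{1}(divnK l'n) dvdn_mul.
have ll'0 : (0 < l * l')%N by rewrite muln_gt0 (ltnW l1) (ltnW l'1).
by rewrite -(dvdn_pmul2r ll'0) mulnACA !divnK // dvdn_pmul2l.
Qed.

Lemma wzd_vertexE (n : nat) (x : 'Z_n) : (1 < n)%N ->
  ((x != 0%R) && zero_divisor x) = (1 < gcdn x n < n)%N.
Proof.
move=> n1; have n0 := ltnW n1; have xn := ltn_Zp x n1.
have g_gt0 : (0 < gcdn x n)%N by rewrite gcdn_gt0 n0 orbT.
have -> : (x != 0)%R = (gcdn x n < n)%N.
  rewrite Zp_neq0 // ltn_neqAle dvdn_leq ?dvdn_gcdr // andbT; congr (~~ _).
  by apply/gcdn_idPr/eqP.
rewrite andbC; apply: andb_id2r => gn.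
apply/existsP/idP => [[y /andP[y0]]|g1].
  rewrite Zp_mul_eq0 // => xy; rewrite ltn_neqAle g_gt0 andbT.
  apply: contraTneq y0 => g1; rewrite Zp_neq0 // negbK.
  by rewrite -(@Gauss_dvdr _ x) // coprime_sym /coprime -g1.
have [y y0 yE] := Zp_codivisor n1 g1 (dvdn_gcdr x n).
exists y; rewrite y0 Zp_mul_eq0 // yE muln_divA ?dvdn_gcdr // mulnC.
by rewrite -muln_divA ?dvdn_gcdl // dvdn_mulr.
Qed.

(** The residues with gcd d are the i d with i < n / d coprime to n / d. *)
Lemma card_gcd_Zp (n d : nat) : (1 < n)%N -> (d %| n)%N ->
  #|[set x : 'Z_n | gcdn x n == d]| = totient (n %/ d).
Proof.
move=> n1 dn; have n0 := ltnW n1; have d0 := dvdn_gt0 n0 dn.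
have -> : totient (n %/ d) = #|[set i : 'I_(n %/ d) | coprime (n %/ d) i]|.
  rewrite totient_count_coprime big_mkord -sum1dep_card [RHS]big_mkcond.
  by apply: eq_bigr => i _; case: coprime.
have lt_Z (i : 'I_(n %/ d)) : (i * d < (Zp_trunc n).+2)%N.
  by rewrite Zp_cast // -ltn_divRL.
pose g (i : 'I_(n %/ d)) : 'Z_n := Ordinal (lt_Z i).
have g_inj : injective g.
  by move=> i j [/eqP]; rewrite eqn_pmul2r // => /eqP/val_inj.
rewrite -(card_imset _ g_inj); apply: eq_card => x; rewrite !inE.
have gcdE i : (gcdn (i * d) n == d) = coprime (n %/ d) i.
  rewrite -{1}(divnK dn) -muln_gcdl -[X in _ == X]mul1n eqn_pmul2r //.
  by rewrite coprime_sym.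
apply/idP/imsetP => [|[i]]; last by rewrite inE -gcdE => ? ->.
move=> gx; have dx : (d %| x)%N by rewrite -(eqP gx) dvdn_gcdl.
have lt_x : (x %/ d < n %/ d)%N by rewrite ltn_divRL // divnK // ltn_Zp.
exists (Ordinal lt_x); last by apply/val_inj; rewrite /= divnK.
by rewrite inE -gcdE /= divnK.
Qed.

(** * Divisors with complementary factors *)

(** Take smallest prime factors l of d and l' of e.  If l l' does not divide n,
then l = l' and l exactly divides n; if moreover d, say, differs from l, then
d / l can replace l, because l (d / l) = d divides n. *)
Lemma complementary_divisorsP (n d e : nat) :
  (1 < d)%N -> (1 < e)%N -> (0 < n)%N -> (d %| n)%N -> (e %| n)%N ->
  (exists l l', [/\ 1 < l, 1 < l', l %| d, l' %| e & l * l' %| n]%N) <->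
  ~~ [&& d == e, prime d & logn d n == 1%N].
Proof.
move=> d1 e1 n0 dn en.
split=> [[l [l' [l1 l'1 ld l'e ll'n]]]|].
  apply/and3P => -[/eqP de d_pr /eqP lg]; rewrite -{}de in l'e.
  have eq_d c : (1 < c -> c %| d -> c = d)%N.
    by move=> c1 /(prime_nt_dvdP d_pr (negbT (gtn_eqF c1))).
  rewrite (eq_d l) // (eq_d l') // mulnn pfactor_dvdn // lg in ll'n.
  by [].
move=> nsimple; have [l_pr l'_pr] : prime (pdiv d) /\ prime (pdiv e).
  by split; apply: pdiv_prime.
have [ll'|ll'] := boolP (pdiv d * pdiv e %| n)%N.
  by exists (pdiv d), (pdiv e); rewrite ?prime_gt1 ?pdiv_dvd.
move: l_pr l'_pr ll'; set l := pdiv d; set l' := pdiv e => l_pr l'_pr ll'.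
have ld : (l %| d)%N by apply: pdiv_dvd.
have l'e : (l' %| e)%N by apply: pdiv_dvd.
have ln := dvdn_trans ld dn; have l'n := dvdn_trans l'e en.
have ll'E : l = l'.
  apply: contraNeq ll' => ne_ll'; rewrite Gauss_dvd ?ln ?l'n //.
  by rewrite prime_coprime // dvdn_prime2.
rewrite -ll'E in l'e l'n ll' *.
have lg : logn l n = 1%N.
  apply/eqP; rewrite eqn_leq logn_gt0 mem_primes l_pr n0 ln leqNgt.
  by rewrite !andbT -pfactor_dvdn // -mulnn.
have extra c : (l %| c -> c %| n -> c != l ->
    exists2 l', 1 < l' & (l' %| c) && (l * l' %| n))%N.
  move=> lc cn c_neq; exists (c %/ l)%N; last first.
    by rewrite dvdn_div // mulnC divnK.
  rewrite ltn_divRL // mul1n ltn_neqAle eq_sym c_neq dvdn_leq //.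
  exact: dvdn_gt0 n0 cn.
have l1 := prime_gt1 l_pr.
have [d_l|d_neq] := eqVneq d l; last first.
  have [c c1 /andP[cd lcn]] := extra d ld dn d_neq.
  by exists c, l; split=> //; rewrite [(c * l)%N]mulnC.
have [e_l|e_neq] := eqVneq e l; last first.
  by have [c c1 /andP[ce lcn]] := extra e l'e en e_neq; exists l, c.
by case/negP: nsimple; rewrite d_l e_l eqxx l_pr lg.
Qed.

(** An intrinsic description, in terms of n alone, of the primes p_i of its
factorization. *)
Lemma mem_simple_prime_factors (m r n : nat)
    (p : 'I_m -> nat) (q k : 'I_r -> nat) (d : nat) :
    (forall j, (2 <= k j)%N) ->
    (forall i, prime (p i)) -> (forall j, prime (q j)) ->
    injective p -> (forall i j, p i != q j) ->
    n = ((\prod_(i < m) p i) * \prod_(j < r) q j ^ k j)%N ->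
  (d \in codom p) = prime d && (logn d n == 1%N).
Proof.
move=> k_ge2 p_pr q_pr p_inj pq_neq nE.
have n0 : (0 < n)%N.
  by rewrite nE muln_gt0 !prodn_gt0 // => [j|i]; rewrite ?expn_gt0 prime_gt0.
apply/codomP/andP => [[i ->]|[d_pr /eqP lg]].
  split=> //; rewrite nE (bigD1 i) //= -mulnA mulnC logn_Gauss; last first.
    rewrite prime_coprime // Euclid_dvdM // !Euclid_dvd_prod // !big_orE.
    rewrite negb_or; apply/andP; split; apply/existsP => -[j] /andP[].
      by move=> ji; rewrite dvdn_prime2 // (inj_eq p_inj) eq_sym (negPf ji).
    by rewrite Euclid_dvdX // dvdn_prime2 // (negPf (pq_neq i j)).
  by rewrite logn_prime // eqxx.
have: (d %| n)%N by rewrite -[d]expn1 pfactor_dvdn // lg.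
rewrite {1}nE Euclid_dvdM // !Euclid_dvd_prod // !big_orE.
case/orP => /existsP[j] /= => [|].
  by rewrite dvdn_prime2 // => /eqP->; exists j.
rewrite Euclid_dvdX // dvdn_prime2 // => /andP[/eqP dq _].
have: (d ^ 2 %| n)%N.
  by rewrite nE (bigD1 j) //= dq mulnCA dvdn_mulr // dvdn_exp2l.
by rewrite pfactor_dvdn // lg.
Qed.

(** * The weakly zero-divisor graph of Z_n *)

Lemma wzd_adjE (n : nat) (x y : wzd_vertex 'Z_n) : (1 < n)%N ->
  wzd_adj x y =
  (x != y) && ~~ [&& gcdn (val x) n == gcdn (val y) n, prime (gcdn (val x) n)
                   & logn (gcdn (val x) n) n == 1%N].
Proof.
move=> n1; congr (_ && _).
have gcd_gt1 (z : wzd_vertex 'Z_n) : (1 < gcdn (val z) n)%N.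
  by have /andP[] : (1 < gcdn (val z) n < n)%N
    by rewrite -wzd_vertexE // (valP z).
have [divP1 divP2] := complementary_divisorsP (gcd_gt1 x) (gcd_gt1 y) (ltnW n1)
  (dvdn_gcdr _ _) (dvdn_gcdr _ _).
have [annP1 annP2] := annihilating_pairP (val x) (val y) n1.
apply/idP/idP => [/exists_inP[r rx /exists_inP[s sy /and3P[r0 s0 rs]]]
                  | /divP2].
  rewrite !inE !Zp_mul_eq0 // in rx sy.
  have [|l [l' [l1 l'1 lx l'y ll'n]]] := annP1; first by exists r, s.
  apply: divP1; exists l, l'; rewrite !dvdn_gcd lx l'y l1 l'1 ll'n.
  split=> //=; apply: dvdn_trans ll'n; [exact: dvdn_mulr | exact: dvdn_mull].
move=> [l [l' [l1 l'1]]]; rewrite !dvdn_gcd => /andP[lx _] /andP[l'y _] ll'n.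
have [|r [s [r0 s0 rx sy rs]]] := annP2; first by exists l, l'.
apply/exists_inP; exists r; first by rewrite inE Zp_mul_eq0.
by apply/exists_inP; exists s; rewrite ?r0 ?s0 // inE Zp_mul_eq0.
Qed.

Lemma card_gcd_wzd_vertex (n d : nat) : d \in proper_divisors n ->
  #|[set x : wzd_vertex 'Z_n | gcdn (val x) n == d]| = totient (n %/ d).
Proof.
rewrite mem_filter => /andP[d1n]; have [d1 dn] := andP d1n.
have n1 := ltn_trans d1 dn; have n0 := ltnW n1.
rewrite -dvdn_divisors // => d_n; rewrite -(card_gcd_Zp n1 d_n).
rewrite -(card_imset _ val_inj); apply: eq_card => x; rewrite !inE.
apply/imsetP/idP => [[y]|gx]; first by rewrite inE => ? ->.
have xP : (x != 0%R) && zero_divisor x by rewrite wzd_vertexE // (eqP gx).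
by exists (exist _ x xP); rewrite ?inE.
Qed.

(** The classes of vertices with a given gcd d, for d a proper divisor of n,
partition the vertex set, and each has phi(n / d) elements. *)
Lemma sum_totient_proper_divisors (n : nat) (Q : pred nat) : (1 < n)%N ->
  \sum_(d <- proper_divisors n | Q d) totient (n %/ d) =
  #|[pred x : wzd_vertex 'Z_n | Q (gcdn (val x) n)]|.
Proof.
move=> n1; have n0 := ltnW n1; rewrite big_seq_cond.
under eq_bigr => d /andP[dP _] do rewrite -card_gcd_wzd_vertex // -sum1dep_card.
pose P (x : wzd_vertex 'Z_n) := Q (gcdn (val x) n).
rewrite -big_seq_cond (exchange_big_dep P) /=; last first.
  by rewrite /P => d x Qd /eqP->.
rewrite -sum1_card; apply: eq_bigr => x; rewrite /P => Qx.
rewrite (eq_bigl (pred1 (gcdn (val x) n))) => [|d /=]; last first.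
  by rewrite eq_sym; case: eqP => [->|_]; rewrite ?Qx ?andbF.
rewrite sum1_count count_uniq_mem ?proper_divisors_uniq // mem_filter.
by rewrite -wzd_vertexE // (valP x) -dvdn_divisors // dvdn_gcdr.
Qed.

Local Open Scope ring_scope.

(** * The Laplacian of a complete multipartite graph *)

(** A division-free form of det(1 - P B) = det(1 - B P): both sides compute
the determinant of the block matrix with rows (A, P) and (B, 1) multiplied by
det A', the left one by clearing its lower left corner, the right one by
clearing its upper right corner with the help of A P = P A'. *)
Lemma det_intertwined (R : comNzRingType) (n k : nat) (A : 'M[R]_n)
    (A' : 'M[R]_k) (P : 'M[R]_(n, k)) (B : 'M[R]_(k, n)) :
  A *m P = P *m A' ->
  \det (A - P *m B) * \det A' = \det A * \det (A' - B *m P).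
Proof.
move=> AP; pose K := block_mx A P B 1%:M.
have detK : \det K = \det (A - P *m B).
  have KE : K *m block_mx 1%:M 0 (- B) 1%:M = block_mx (A - P *m B) P 0 1%:M.
    by rewrite mulmx_block !mulmx1 !mulmx0 !mul1mx !add0r subrr mulmxN.
  have := congr1 determinant KE; rewrite det_mulmx det_lblock det_ublock.
  by rewrite !det1 !mulr1.
have KE : K *m block_mx 1%:M (- P) 0 A' = block_mx A 0 B (A' - B *m P).
  rewrite mulmx_block !mulmx1 !mulmx0 !mulmxN !addr0 AP addNr mul1mx.
  by rewrite [- _ + _]addrC.
have := congr1 determinant KE.
by rewrite det_mulmx detK det_lblock det_ublock det1 mul1r.
Qed.

Lemma det_scalar_add_rank1 (R : idomainType) (k : nat) (y : R)
    (u : 'cV[R]_k.+1) (v : 'rV[R]_k.+1) :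
  y != 0 -> \det (y%:M + u *m v) = y ^+ k * (y + (v *m u) 0 0).
Proof.
move=> y0; apply: (mulIf y0).
have := @det_intertwined _ _ _ y%:M y%:M u (- v).
rewrite mulmxN opprK det_scalar1 mul_scalar_mx mul_mx_scalar => -> //.
rewrite det_scalar mulNmx opprK det_mx11 !mxE eqxx mulr1n exprSr.
by rewrite mulrAC.
Qed.

(** The parts are the fibres of f.  The surjectivity of f makes each exponent
(c t).-1 a true predecessor. *)
Lemma char_poly_complete_multipartite (F : idomainType) (G : sgraph)
    (T : finType) (f : G -> T) (c := fun t => #|[set x | f x == t]|) :
  (forall x y, adj x y = (f x != f y)) -> (forall t, exists x, f x = t) ->
  (0 < #|T|)%N ->
  char_poly (laplacian F G) =
    'X * ('X - #|G|%:R%:P) ^+ #|T|.-1 *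
    \prod_t ('X - (#|G|%:R - (c t)%:R)%:P) ^+ (c t).-1.
Proof.
move=> adjE f_surj T_gt0.
have c_gt0 t : (0 < c t)%N.
  by have [x fx] := f_surj t; apply/card_gt0P; exists x; rewrite inE fx.
have degE x : (degree x)%:R = #|G|%:R - (c (f x))%:R :> F.
  rewrite -natrB ?max_card // /c /degree -[#|G|](cardsC [set y | f y == f x]).
  rewrite addKn; congr (_%:R); apply: eq_card => y.
  by rewrite !inE adjE eq_sym.
pose y : {poly F} := 'X - #|G|%:R%:P.
have y0 : y != 0 by rewrite polyXsubC_eq0.
pose e t : {poly F} := 'X - (#|G|%:R - (c t)%:R)%:P.
have eE t : e t = y + (c t)%:R.
  by rewrite /e /y polyCB opprB addrCA addrC !polyC_natr.
pose fi i := f (@enum_val G G i).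
pose A := diag_mx (\row_i e (fi i)).
pose A' := diag_mx (\row_j e (@enum_val T T j)).
pose P : 'M[{poly F}]_(#|G|, #|T|) := \matrix_(i, j) (fi i == enum_val j)%:R.
pose B : 'M[{poly F}]_(#|T|, #|G|) :=
  \matrix_(j, i) ((fi i == enum_val j)%:R - 1).
have sum_fi t : \sum_i (fi i == t)%:R = (c t)%:R :> {poly F}.
  rewrite -(big_enum_val (fun x => (f x == t)%:R)) -natr_sum; congr (_%:R).
  by rewrite -big_mkcond sum1dep_card.
have sum_T t F0 :
    \sum_j (t == @enum_val T T j)%:R * F0 (enum_val j) = F0 t :> {poly F}.
  rewrite -(big_enum_val (fun s => (t == s)%:R * F0 s)) (bigD1 t) //=.
  rewrite eqxx mul1r big1 ?addr0 // => s.
  by rewrite eq_sym => /negPf->; rewrite mul0r.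
have APE : A *m P = P *m A'.
  apply/matrixP => i j; rewrite mul_diag_mx mul_mx_diag !mxE.
  by case: eqP => [->|_]; rewrite ?mulr1 ?mul1r // mulr0 mul0r.
(* On the diagonal P B vanishes and A has the entry 'X minus the degree. *)
have LE : char_poly_mx (laplacian F G) = A - P *m B.
  apply/matrixP => i j; rewrite !mxE.
  under eq_bigr do rewrite !mxE.
  rewrite (sum_T (fi i) (fun t => (fi j == t)%:R - 1)) adjE degE.
  rewrite -/(fi i) -/(fi j).
  rewrite polyCB polyCMn /e.
  case: (eqVneq i j) => [->|ij]; rewrite ?eqxx /= ?mulr1n ?mulr0n ?add0r.
    by rewrite !subr0 subrr subr0.
  by rewrite opprK polyC_natr eq_sym; case: eqP => _;
    rewrite ?subrr ?oppr0 ?sub0r ?opprK.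
have A'E : A' - B *m P =
    y%:M + const_mx 1 *m (\row_j (c (@enum_val T T j))%:R : 'rV_#|T|).
  apply/matrixP => i j; rewrite !mxE big_ord1 !mxE mul1r eE.
  under eq_bigr do rewrite !mxE mulrBl mul1r.
  rewrite sumrB sum_fi opprB.
  rewrite (eq_bigr (fun l => (i == j)%:R * (fi l == enum_val j)%:R)); last first.
    move=> l _; case: (eqVneq i j) => [->|ij].
      by case: eqP; rewrite ?mulr1 ?mulr0.
    rewrite mul0r -natrM mulnb; case: (eqVneq (fi l) (enum_val i)) => //= ->.
    by rewrite (inj_eq enum_val_inj) (negPf ij).
  rewrite -mulr_sumr sum_fi; case: (eqVneq i j) => [->|ij].
    by rewrite !mulr1n mul1r [_ - _]addrC addrA addrK.
  by rewrite !mulr0n mul0r subr0.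
have detA : \det A = \prod_t e t ^+ c t.
  rewrite det_diag; under eq_bigr do rewrite mxE.
  rewrite -(big_enum_val (fun x => e (f x))) (partition_big f predT) //=.
  apply: eq_bigr => t _; rewrite (eq_bigr (fun=> e t)) => [|x /eqP-> //].
  by rewrite prodr_const; congr (_ ^+ _); apply: eq_card => x; rewrite !inE.
have detA' : \det A' = \prod_t e t.
  rewrite det_diag; under eq_bigr do rewrite mxE.
  by rewrite -(big_enum_val e).
have detA'B : \det (A' - B *m P) = y ^+ #|T|.-1 * 'X.
  rewrite {}A'E; have sumc : \sum_(j < #|T|) (c (enum_val j)) = #|G|.
    rewrite -(big_enum_val c) -sum1_card (partition_big f predT) //=.
    by apply: eq_bigr => t _; rewrite sum1dep_card.
  pose u : 'cV[{poly F}]_#|T| := const_mx 1; rewrite -/u.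
  have uj j : u j 0 = 1 by rewrite mxE.
  pose w : 'rV[{poly F}]_#|T| := \row_j (c (@enum_val T T j))%:R.
  have wu : (w *m u) 0 0 = #|G|%:R.
    rewrite mxE -sumc natr_sum; apply: eq_bigr => j _; by rewrite mxE uj mulr1.
  rewrite -/w; clearbody u w; move: u w wu {uj}.
  rewrite -(prednK T_gt0) => u w wu.
  by rewrite det_scalar_add_rank1 // wu /y polyC_natr subrK.
(* det A' is monic, so it can be cancelled from the intertwining identity. *)
have e0 : \prod_t e t != 0.
  by apply/prodf_neq0 => t _; rewrite polyXsubC_eq0.
apply: (mulIf e0); rewrite /char_poly LE -[in LHS]detA' det_intertwined //.
rewrite detA detA'B -/y mulrC [_ * 'X]mulrC -!mulrA; congr (_ * (_ * _)).
rewrite -big_split /=; apply: eq_bigr => t _.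
by rewrite -exprSr prednK.
Qed.

Lemma prod_tally_seq (R : pzRingType) (T : eqType) (bs : seq (T * nat))
    (F : T -> R) :
  \prod_(z <- tally_seq bs) F z = \prod_(b <- bs) F b.1 ^+ b.2.
Proof.
rewrite /tally_seq big_flatten big_map; apply: eq_bigr => b _.
by rewrite big_nseq -Monoid.iteropE.
Qed.

(** * The spectrum *)

Theorem theorem4p3 (C : numClosedFieldType) (m r n : nat)
    (p : 'I_m -> nat) (q k : 'I_r -> nat)
    (m_ge1 : (1 <= m)%N)
    (k_ge2 : forall j, (2 <= k j)%N)
    (p_prime : forall i, prime (p i))
    (q_prime : forall j, prime (q j))
    (p_inj : injective p)
    (q_inj : injective q)
    (pq_neq : forall i j, p i != q j)
    (n_def : n = ((\prod_(i < m) p i) * \prod_(j < r) q j ^ k j)%N)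
    (n_nprime : ~~ prime n) :
  let G := wzd_graph 'Z_n in
  perm_eq (spectrum (laplacian C G))
    (tally_seq
      [:: (0, 1%N),
          (#|G|%:R,
           ((\sum_(d <- proper_divisors n | d \notin codom p) totient (n %/ d))
              + m - 1)%N)
        & [seq (#|G|%:R - (totient (n %/ p i))%:R,
                (totient (n %/ p i) - 1)%N) | i : 'I_m]])
  /\ laplacian_integral C G.
Proof.
move=> G.
have p_dvd i : (p i %| n)%N by rewrite n_def (bigD1 i) //= -mulnA dvdn_mulr.
have n_gt0 : (0 < n)%N.
  by rewrite n_def muln_gt0 !prodn_gt0 // => j; rewrite ?expn_gt0 prime_gt0.
have p_proper i : p i \in proper_divisors n.
  rewrite mem_proper_divisors // prime_gt1 // p_dvd andbT.
  by rewrite ltn_neqAle dvdn_leq // andbT; apply: contraNneq n_nprime => <-.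
have i0 : 'I_m := Ordinal m_ge1.
have n_gt1 : (1 < n)%N.
  by have := p_proper i0; rewrite mem_filter => /andP[/andP[/ltn_trans h /h]].
have memp :=
  mem_simple_prime_factors _ k_ge2 p_prime q_prime p_inj pq_neq n_def.
pose g (x : G) := gcdn (val x) n.
(* The parts: one for each p i, and a singleton for every other vertex. *)
pose S := {x : G | g x \notin codom p}.
pose T : finType := ('I_m + S)%type.
pose f (x : G) : T :=
  if insub x is Some u then inr u else inl (odflt i0 [pick i | p i == g x]).
(* The default i0 is never reached: outside S, the gcd of x is some p i. *)
have f_inl x i : (f x == inl i) = (g x == p i).
  rewrite /f; case: insubP => [u Pu _|]; last rewrite negbK => /codomP[j gj].
    by apply/esym/negP => /eqP gx; rewrite gx codom_f in Pu.
  case: pickP => [j' /eqP j'E|/(_ j)]; last by rewrite gj eqxx.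
  by rewrite -j'E (inj_eq p_inj).
have f_inr x u : (f x == inr u) = (x == val u).
  rewrite /f; case: insubP => [v _ <-|]; first by rewrite (inj_eq val_inj).
  by move=> xP; apply/esym/negP => /eqP xu; rewrite xu (valP u) in xP.
have adjE (x y : G) : adj x y = (f x != f y).
  rewrite /= wzd_adjE // -memp -negb_or -/(g x) -/(g y); congr (~~ _).
  case fy: (f y) => [i|u]; move/eqP: fy.
    rewrite !f_inl => /eqP gy; case: eqVneq => [->|_] /=.
      by rewrite gy eqxx.
    by rewrite gy; case: eqP => //= ->; rewrite codom_f.
  rewrite !f_inr => /eqP->; case: eqP => //= _.
  by apply/negP => /andP[/eqP->]; apply/negP/(valP u).
have f_surj t : exists x, f x = t.
  case: t => [i|u]; last by exists (val u); apply/eqP; rewrite f_inr.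
  have : (0 < totient (n %/ p i))%N.
    by rewrite totient_gt0 divn_gt0 ?prime_gt0 // dvdn_leq.
  rewrite -(card_gcd_wzd_vertex (p_proper i)) => /card_gt0P[x].
  by rewrite inE => gx; exists x; apply/eqP; rewrite f_inl.
have cardT : #|T| = ((\sum_(d <- proper_divisors n | d \notin codom p)
                       totient (n %/ d)) + m)%N.
  by rewrite sum_totient_proper_divisors // card_sum card_ord addnC card_sig.
have T_gt0 : (0 < #|T|)%N by rewrite cardT addn_gt0 m_ge1 orbT.
have spectrumE : perm_eq (spectrum (laplacian C G)) (tally_seq
      [:: (0, 1%N), (#|G|%:R, (#|T| - 1)%N)
        & [seq (#|G|%:R - (totient (n %/ p i))%:R,
                (totient (n %/ p i) - 1)%N) | i : 'I_m]]).
  apply: prod_XsubC_eq; rewrite -spectrumP.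
  rewrite (char_poly_complete_multipartite _ adjE f_surj T_gt0).
  rewrite prod_tally_seq !big_cons /= polyC0 subr0 expr1 subn1 -mulrA.
  congr (_ * (_ * _)); rewrite big_image /= big_sumType /=.
  rewrite [X in _ * X]big1 => [|u _]; last first.
    have -> : #|[set x | f x == inr u]| = 1%N; last by rewrite expr0.
    by rewrite -(card1 (val u)); apply: eq_card => x; rewrite !inE f_inr.
  rewrite mulr1; apply: eq_bigr => i _; rewrite subn1.
  rewrite -(card_gcd_wzd_vertex (p_proper i)).
  by congr (('X - (_ - _%:R)%:P) ^+ _.-1); apply: eq_card => x;
    rewrite !inE f_inl.
rewrite -cardT; split=> // a.
rewrite -mem_spectrum (perm_mem spectrumE) => /flatten_mapP[b].
rewrite !inE => /or3P[/eqP->|/eqP->|/imageP[i _ ->]];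
  rewrite mem_nseq => /andP[_ /eqP->] /=.
- by exists 0; rewrite rmorph0.
- by exists #|G|%:Z.
by exists (#|G|%:Z - (totient (n %/ p i))%:Z); rewrite rmorphB.
Qed.
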